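(* Let $m\in\mathbb{N}$, let $\mathbf{V}$ be an $(m+1)$-dimensional vector space over a (commutative) field $F$ with characteristic $p>0$, and let $\sum_{\lambda\in\mathbb{N}}t_\lambda p^\lambda$ (with $t_\lambda\in\{0,1,\ldots,p-1\}$, only finitely many non-zero) be the representation of $t\in\mathbb{N}$ in base $p$. If $\#F\geq t$, then $$\prod_{\lambda\in\mathbb{N}}\binom{m+t_\lambda}{t_\lambda}=\prod_{\lambda\in\mathbb{N}}\binom{m+t_\lambda}{m}$$ is equal to the dimension of the subspace of the $t$-th symmetric power of $\mathbf{V}$ which is spanned by $\{\mathbf{a}^t\mid\mathbf{a}\in\mathbf{V}\}$.
   Context: $\mathbb{N}=\{0,1,2,\ldots\}$. The $t$-th symmetric power $S^t\mathbf{V}$ is the degree-$t$ component of the symmetric algebra of $\mathbf{V}$ (with $S^0\mathbf{V}=F$), and $\mathbf{a}^t=\mathbf{a}\cdot\mathbf{a}\cdots\mathbf{a}$ ($t$ factors) is the $t$-th power of $\mathbf{a}$ taken in the symmetric algebra (for $t=0$ this is $1\in F$). *)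

(* Defs.v *)
From HB Require Import structures.
From mathcomp Require Import all_boot all_order all_algebra.
From mathcomp Require Import mpoly.

Set Implicit Arguments.
Unset Strict Implicit.
Unset Printing Implicit Defensive.

Import GRing.Theory.
Local Open Scope ring_scope.

Section LinearSpan.
Context {F : fieldType} {W : lmodType F}.

(* The ambient module W may be infinite-dimensional, so subspaces and their
   dimensions are not available as {vspace W} and \dim. *)
Definition lin_span (X : W -> Prop) (w : W) : Prop :=
  exists (k : nat) (c : 'I_k -> F) (x : 'I_k -> W),
    (forall i, X (x i)) /\ w = \sum_(i < k) c i *: x i.

Definition has_dim (U : W -> Prop) (d : nat) : Prop :=
  exists e : 'I_d -> W,
    (forall c : 'I_d -> F, \sum_(i < d) c i *: e i = 0 -> forall i, c i = 0)
    /\ (forall w, U w <-> exists c : 'I_d -> F, w = \sum_(i < d) c i *: e i).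

End LinearSpan.

Section SymmetricAlgebra.
Context {F : fieldType} {V : lmodType F} {S : comAlgType F}.
Variable iota : {linear V -> S}.

(* Universal property: iota : V -> S is initial among the linear maps from V to
   commutative F-algebras. A comAlgType is non-zero, which loses nothing: every
   linear map to the zero algebra factors uniquely. *)
Definition is_symmetric_algebra : Prop :=
  forall (A : comAlgType F) (f : {linear V -> A}),
    (exists g : {lrmorphism S -> A}, forall v, g (iota v) = f v)
    /\ (forall g h : {lrmorphism S -> A},
          (forall v, g (iota v) = f v) -> (forall v, h (iota v) = f v) ->
          g =1 h).

(* The degree-t component of the symmetric algebra. *)
Definition sym_power (t : nat) : S -> Prop :=
  lin_span (fun s => exists v : 'I_t -> V, s = \prod_(i < t) iota (v i)).

Definition power_span (t : nat) : S -> Prop :=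
  lin_span (fun s => exists a : V, s = iota a ^+ t).

End SymmetricAlgebra.

Arguments is_symmetric_algebra {F V S} iota.

(* Symmetric algebras of finite-dimensional spaces exist: polynomial rings. *)
Section Existence.
Variables (F : fieldType) (V : vectType F).

Let n := \dim {:V}.

Definition sym_iota (v : V) : {mpoly F[n]} :=
  \sum_(i < n) coord (vbasis {:V}) i v *: 'X_i.

Fact sym_iota_is_linear : linear sym_iota.
Proof.
move=> c u v; rewrite /sym_iota scaler_sumr -big_split /=.
by apply: eq_bigr => i _; rewrite linearP scalerDl scalerA.
Qed.

HB.instance Definition _ :=
  GRing.isLinear.Build F V {mpoly F[n]} _ sym_iota sym_iota_is_linear.

Fact sym_iota_basis (i : 'I_n) : sym_iota (vbasis {:V})`_i = 'X_i.
Proof.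
rewrite /sym_iota (bigD1 i) //= big1 ?addr0 => [|j ji].
  by rewrite coord_free ?eqxx ?scale1r // (basis_free (vbasisP _)).
by rewrite coord_free ?(basis_free (vbasisP _)) // eq_sym (negPf ji) scale0r.
Qed.

Lemma symmetric_algebra_exists : is_symmetric_algebra sym_iota.
Proof.
move=> A f; split=> [|g h gf hf p]; last first.
  have ghX (i : 'I_n) : g 'X_i = h 'X_i by rewrite -sym_iota_basis gf hf.
  rewrite [p]mpolyE !linear_sum /=; apply: eq_bigr => m _.
  rewrite !linearZ /= mpolyXE_id !rmorph_prod /=; congr (_ *: _).
  by apply: eq_bigr => i _; rewrite !rmorphXn /= ghX.
pose x (i : 'I_n) : A := f (vbasis {:V})`_i.
pose g : {rmorphism {mpoly F[n]} -> A} := mmap (in_alg A) x.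
have g_lin : scalable g by move=> c p; rewrite /g /= mmapZ /= mulr_algl.
pose gL := GRing.isScalable.Build F {mpoly F[n]} A *:%R g g_lin.
pose g' : {lrmorphism {mpoly F[n]} -> A} := HB.pack (g : _ -> _) g gL.
exists g' => v; rewrite /= /sym_iota raddf_sum /=.
rewrite [in RHS](coord_vbasis (memvf v)) linear_sum; apply: eq_bigr => i _.
by rewrite mmapZ /= mulr_algl mmapX mmap1U linearZ.
Qed.

End Existence.

(* Main.v *)
Require Import Defs.
From HB Require Import structures.
From mathcomp Require Import all_boot all_order all_algebra.
From mathcomp Require Import mpoly.

Set Implicit Arguments.
Unset Strict Implicit.

Import GRing.Theory.
Local Open Scope ring_scope.

(**
Write b_0, ..., b_m for a basis of V and P_t for (X_0 + ... + X_m)^t, a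
polynomial over F. For a = \sum x_i b_i, substituting x_i b_i for X_i in P_t
gives

   a^t = \sum_k P_t[k] x^k b^k,     k ranging over the support of P_t,

where x^k and b^k are the monomials of exponent k ([power_expansion]). Hence
the powers a^t lie in the span of the monomials b^k whose exponent is in the
support of P_t, i.e. whose multinomial coefficient is non-zero in F. These
monomials are independent, because the universal property maps them to the
monomials of a polynomial ring ([basis_monomial_free]). When F has at least t
elements they conversely lie in the span of the powers
([basis_monomial_in_power_span]): an exponent k whose entries are all below t
is isolated by interpolating on a grid of t^(m+1) points, and the only other
exponents of degree t are those of the pure powers b_i^t, which are t-th powers
already. So the dimension is the number of monomials of P_t
([power_span_dim]).

The number of monomials is computed digit by digit. For d < p the Frobenius
endomorphism gives

   P_(d + p t) = P_d(X) P_t(X^p),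

and an exponent of the product splits uniquely as k = a + p b, because the
entries of a are at most d < p. Therefore the numbers of monomials multiply
([size_msupp_gen_powD]), and no two products can cancel. For a single digit
d < p no multinomial coefficient of degree d vanishes, as d! is invertible in
F, and P_d has all the binomial(m + d, d) monomials of degree d.
*)

(** * Monomials of a power of the sum of the variables *)

Lemma natr_fact_neq0 (F : fieldType) p d :
  p \in [pchar F] -> (d < p)%N -> (d`!)%:R != 0 :> F.
Proof.
move=> pF; elim: d => [|d IHd] dp; first by rewrite oner_eq0.
rewrite factS natrM mulf_neq0 ?IHd 1?ltnW // -(dvdn_pcharf pF).
by rewrite gtnNdvd.
Qed.

Section GenericPower.
Variables (n : nat) (F : fieldType).

Definition gen_pow (t : nat) : {mpoly F[n]} := (\sum_(i < n) 'X_i) ^+ t.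

Lemma gen_pow_mdeg t k : k \in msupp (gen_pow t) -> mdeg k = t.
Proof.
have homog1 : \sum_(i < n) 'X_i \is [in F[n], 1.-homog].
  by apply: rpred_sum => i _; rewrite dhomogX /= mdeg1.
by move=> kP; have /dhomogP/(_ k kP) := dhomogMn t homog1; rewrite /= mul1n.
Qed.

Lemma gen_pow_deriv t i : (gen_pow t.+1)^`M(i) = gen_pow t *+ t.+1.
Proof.
have dX : (\sum_(j < n) 'X_j : {mpoly F[n]})^`M(i) = 1.
  rewrite raddf_sum (bigD1 i) //= big1 ?addr0 => [|j ji]; rewrite mderivX mnm1E.
    by rewrite eqxx scale1r -{1}[U_(i)%MM]add0m addmK mpolyX0.
  by rewrite (negPf ji) scale0r.
elim: t => [|t IHt].
  by rewrite /gen_pow expr1 expr0 dX.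
rewrite {1}/gen_pow exprS mderivM dX mul1r -/(gen_pow _) IHt.
by rewrite mulrnAr -exprS -/(gen_pow _) -mulrS.
Qed.

(** The derivative in X_i of (\sum X_j)^(t+1) is (t+1) (\sum X_j)^t, so a
coefficient in degree t+1 times an exponent is t+1 times a coefficient in degree
t: non-vanishing propagates upwards as long as t! is invertible. *)
Lemma gen_pow_small t : (t`!)%:R != 0 :> F ->
  forall k, (k \in msupp (gen_pow t)) = (mdeg k == t).
Proof.
move=> t_nz k; apply/idP/eqP => [/gen_pow_mdeg //|].
elim: t t_nz k => [|t IHt] t_nz k kt; rewrite mcoeff_msupp.
  move/eqP: kt; rewrite mdeg_eq0 => /eqP ->.
  by rewrite /gen_pow expr0 mcoeff1 eqxx oner_eq0.
move: t_nz; rewrite factS natrM mulf_eq0 negb_or => /andP[t1_nz t_nz].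
have [i ki | k0] := pickP (fun i => 0 < k i)%N; last first.
  suff k_eq0 : k == 0%MM by rewrite -mdeg_eq0 kt in k_eq0.
  apply/eqP/mnmP => i; rewrite mnm0E; apply/eqP.
  by rewrite -leqn0 leqNgt k0.
pose m := (k - U_(i))%MM.
have km : k = (m + U_(i))%MM.
  by rewrite submK //; apply/mnm_lepP => j; rewrite mnm1E; case: eqP => // <-.
have mt : mdeg m = t by apply: succn_inj; rewrite -kt km mdegD mdeg1 addn1.
have := IHt t_nz m mt; rewrite mcoeff_msupp km; apply: contraNneq => P0.
have := mcoeff_mderiv i (gen_pow t.+1) m.
rewrite gen_pow_deriv P0 mul0rn mcoeffMn -mulr_natr => /eqP.
by rewrite mulf_eq0 (negPf t1_nz) orbF.
Qed.

Section Frobenius.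
Variable p : nat.
Hypothesis pF : p \in [pchar F].

(** By Frobenius, the p-th power of \sum X_i is \sum X_i^p. *)
Lemma gen_powMp t :
  gen_pow (p * t) = \sum_(b <- msupp (gen_pow t)) (gen_pow t)@_b *: 'X_[b *+ p].
Proof.
have pP : p \in [pchar {mpoly F[n]}] by rewrite pchar_lalg.
have sumXp : (\sum_(i < n) 'X_i) ^+ p = \sum_(i < n) 'X_i ^+ p :> {mpoly F[n]}.
  rewrite -(pFrobenius_autE pP) rmorph_sum.
  by apply: eq_bigr => i _; rewrite /= pFrobenius_autE.
pose lq := [tuple ('X_i ^+ p : {mpoly F[n]}) | i < n].
have -> : gen_pow (p * t) = gen_pow t \mPo lq.
  rewrite /gen_pow exprM sumXp rmorphXn rmorph_sum /=; congr (_ ^+ t).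
  by apply: eq_bigr => i _; rewrite comp_mpolyXU -tnth_nth tnth_mktuple.
rewrite comp_mpolyEX; apply: eq_bigr => b _; congr (_ *: _).
rewrite comp_mpolyX -mpolyXn mpolyXE_id -prodrXl.
by apply: eq_bigr => i _; rewrite tnth_mktuple exprAC.
Qed.

(** Lucas' theorem for multinomial coefficients, in the form of a count: an
exponent of the product determines its two factors as its remainder and its
quotient by p, entry by entry, so that nothing cancels. *)
Lemma size_msupp_gen_powD d t : (d < p)%N ->
  size (msupp (gen_pow (d + p * t))) =
  (size (msupp (gen_pow d)) * size (msupp (gen_pow t)))%N.
Proof.
move=> dp; set A := msupp (gen_pow d); set B := msupp (gen_pow t).
pose lo (k : 'X_{1..n}) := [multinom (k i %% p)%N | i < n].
pose hi (k : 'X_{1..n}) := [multinom (k i %/ p)%N | i < n].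
have a_lt a i : a \in A -> (a i < p)%N.
  move/gen_pow_mdeg => ad; apply: leq_ltn_trans dp.
  by rewrite -ad mdegE (bigD1 i) //= leq_addr.
have p_gt0 : (0 < p)%N by apply: leq_ltn_trans dp.
have loK a b : a \in A -> lo (a + b *+ p)%MM = a.
  move=> aA; apply/mnmP => i; rewrite mnmE mnmDE mulmnE addnC modnMDl.
  by rewrite modn_small ?a_lt.
have hiK a b : a \in A -> hi (a + b *+ p)%MM = b.
  move=> aA; apply/mnmP => i; rewrite mnmE mnmDE mulmnE addnC divnMDl //.
  by rewrite divn_small ?a_lt ?addn0.
pose f k := (gen_pow d)@_(lo k) * (gen_pow t)@_(hi k).
pose r := [seq (a + b *+ p)%MM | a <- A, b <- B].
have -> : gen_pow (d + p * t) = \sum_(k <- r) f k *: 'X_[k].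
  rewrite big_allpairs_dep {1}/gen_pow exprD -!/(gen_pow _) gen_powMp.
  rewrite {1}[gen_pow d]mpolyE mulr_suml [LHS]big_seq [RHS]big_seq.
  apply: eq_bigr => a aA.
  rewrite mulr_sumr; apply: eq_bigr => b _.
  by rewrite /f loK // hiK // mpolyXD -scalerAl -scalerAr scalerA.
rewrite -(size_allpairs (fun a b => a + b *+ p)%MM); apply/perm_size/msupp_sumX.
  apply: allpairs_uniq; rewrite ?msupp_uniq // => ab ab'.
  move=> /allpairsP[[a b] /= [aA _ ->]] /allpairsP[[a' b'] /= [a'A _ ->]] /= e.
  by congr (_, _); [rewrite -(loK a b) // e loK | rewrite -(hiK a b) // e hiK].
move=> k /allpairsP[[a b] /= [aA bB ->]].
by rewrite /f loK // hiK // mulf_neq0 // -mcoeff_msupp.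
Qed.

End Frobenius.
End GenericPower.

Lemma size_msupp_gen_pow_small m (F : fieldType) d : (d`!)%:R != 0 :> F ->
  size (msupp (gen_pow m.+1 F d)) = 'C(m + d, d).
Proof.
move=> d_nz; rewrite addnC -size_basis; apply/perm_size.
apply: uniq_perm; rewrite ?msupp_uniq ?uniq_basis // => k.
by rewrite gen_pow_small // basis_cover.
Qed.

Lemma size_msupp_gen_pow_digits m (F : fieldType) p n (d : nat -> nat) :
  p \in [pchar F] -> (forall l, (d l < p)%N) ->
  size (msupp (gen_pow m.+1 F (\sum_(l < n) d l * p ^ l))) =
  (\prod_(l < n) 'C(m + d l, d l))%N.
Proof.
move=> pF; elim: n d => [|n IHn] d d_lt.
  by rewrite !big_ord0 /gen_pow expr0 msupp1.
rewrite !big_ord_recl expn0 muln1 /= -(IHn (fun l => d l.+1)) //.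
rewrite -(@size_msupp_gen_pow_small m F); last exact: natr_fact_neq0 pF _.
rewrite -(size_msupp_gen_powD m.+1 pF) //.
congr (size (msupp (gen_pow _ _ (_ + _)))).
rewrite big_distrr /=; apply: eq_bigr => l _.
by rewrite expnS mulnCA.
Qed.

(** * Linear spans *)

Section LinSpan.
Variables (F : fieldType) (W : lmodType F) (X : W -> Prop).

Lemma mem_lin_span x : X x -> lin_span X x.
Proof.
by move=> Xx; exists 1%N, (fun _ => 1), (fun _ => x); rewrite big_ord1 scale1r.
Qed.

Lemma lin_spanZ a w : lin_span X w -> lin_span X (a *: w).
Proof.
case=> k [c [x [Xx ->]]]; exists k, (fun i => a * c i), x; split=> //.
by rewrite scaler_sumr; apply: eq_bigr => i _; rewrite scalerA.
Qed.

Lemma lin_spanD u v : lin_span X u -> lin_span X v -> lin_span X (u + v).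
Proof.
move=> [k [c [x [Xx ->]]]] [l [b [y [Xy ->]]]].
pose pick T (f : 'I_k -> T) (g : 'I_l -> T) i :=
  match split i with inl j => f j | inr j => g j end.
exists (k + l)%N, (pick _ c b), (pick _ x y); split=> [i|].
  by rewrite /pick; case: (split i).
rewrite big_split_ord /pick; congr (_ + _); apply: eq_bigr => i _.
  by rewrite -/(unsplit (inl i)) unsplitK.
by rewrite -/(unsplit (inr i)) unsplitK.
Qed.

Lemma lin_span_sum (I : Type) (r : seq I) (P : pred I) (w : I -> W) :
  (forall i, P i -> lin_span X (w i)) -> lin_span X (\sum_(i <- r | P i) w i).
Proof.
move=> Xw; apply: big_ind => //; last exact: lin_spanD.
exists 0%N, (fun _ => 0), (fun _ => 0); rewrite big_ord0.
by split=> // -[].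
Qed.

Lemma lin_span_basis k (e : 'I_k -> W) :
  (forall x, X x -> exists c : 'I_k -> F, x = \sum_(i < k) c i *: e i) ->
  (forall i, lin_span X (e i)) ->
  forall w, lin_span X w <-> exists c : 'I_k -> F, w = \sum_(i < k) c i *: e i.
Proof.
move=> Xe eX w; split=> [[l [a [x [Xx ->]]]]|[c ->]]; last first.
  by apply: lin_span_sum => i _; apply: lin_spanZ.
apply: (big_ind (fun u => exists c : 'I_k -> F, u = \sum_(i < k) c i *: e i)).
- by exists (fun _ => 0); rewrite big1 // => i _; rewrite scale0r.
- move=> _ _ [b ->] [c ->]; exists (fun i => b i + c i).
  by rewrite -big_split; apply: eq_bigr => i _; rewrite scalerDl.
move=> j _; have [c ->] := Xe _ (Xx j); exists (fun i => a j * c i).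
by rewrite scaler_sumr; apply: eq_bigr => i _; rewrite scalerA.
Qed.

End LinSpan.

(** * Isolating a monomial by evaluation *)

(** The evaluation matrix of the monomials with exponents below t on the grid
f('I_t)^n is a tensor power of a Vandermonde matrix; B is the row of index k of
the tensor power of its inverse. *)
Lemma grid_interpolation (F : fieldType) (n t : nat) (f : 'I_t -> F)
    (k : {ffun 'I_n -> 'I_t}) :
  injective f ->
  exists B : {ffun 'I_n -> 'I_t} -> F, forall k' : {ffun 'I_n -> 'I_t},
    \sum_x B x * \prod_(i < n) f (x i) ^+ k' i = (k == k')%:R.
Proof.
move=> f_inj; pose W := (Vandermonde t (\row_j f j))^T.
have W_unit : W \in unitmx.
  rewrite unitmx_tr unitmxE det_Vandermonde unitfE.
  apply/prodf_neq0 => i _; apply/prodf_neq0 => j ij; rewrite !mxE subr_eq0.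
  by apply: contraTneq ij => /f_inj ->; rewrite ltnn.
exists (fun x => \prod_(i < n) invmx W (k i) (x i)) => k'.
under eq_bigr do rewrite -big_split /=.
rewrite -(bigA_distr_bigA (fun i y => invmx W (k i) y * f y ^+ k' i)).
have entry i : \sum_y invmx W (k i) y * f y ^+ k' i = (k i == k' i)%:R.
  have := congr1 (fun M : 'M_t => M (k i) (k' i)) (mulVmx W_unit).
  by rewrite /= !mxE => <-; apply: eq_bigr => y _; rewrite !mxE.
under eq_bigr do rewrite entry.
case: eqP => [->|/eqP k_k']; first by rewrite big1 // => i _; rewrite eqxx.
have [i ki] : exists i, k i != k' i.
  apply/existsP; apply: contraNT k_k'; rewrite negb_exists => /forallP e.
  by apply/eqP/ffunP => i; apply/eqP; have := e i; rewrite negbK.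
by rewrite (bigD1 i) //= (negPf ki) mul0r.
Qed.

(** An exponent of degree t with an entry at least t is that of the pure power
X_i^t. Evaluation at the i-th unit vector, with 0^0 = 1, detects it among all
exponents of degree t, including when t = 0. *)
Lemma full_exponent_delta (F : fieldType) n t i (l k : 'X_{1..n}) :
  l \in msupp (gen_pow n F t) -> k \in msupp (gen_pow n F t) -> (t <= l i)%N ->
  \prod_(j < n) (j == i)%:R ^+ k j = (k == l)%:R :> F.
Proof.
move=> lP kP tli.
have l0 j : j != i -> l j = 0%N.
  move=> ji; have := gen_pow_mdeg lP.
  rewrite mdegE (bigD1 i) //= (bigD1 j) //= => lt.
  apply/eqP; rewrite -leqn0 -(leq_add2l (l i)) addn0.
  by apply: leq_trans tli; rewrite -lt addnA leq_addr.
have at_i q : q \in msupp (gen_pow n F t) ->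
    (forall j, j != i -> q j = 0%N) -> q i = t.
  by move=> /gen_pow_mdeg <- q0; rewrite mdegE (bigD1 i) //= big1 ?addn0.
case: eqP => [->|kl].
  by rewrite big1 // => j _; case: eqP => [_|/eqP/l0 ->]; rewrite ?expr1n.
have [j /andP[ji kj]|k0] := pickP (fun j => (j != i) && (k j != 0%N)).
  by rewrite (bigD1 j) //= (negPf ji) expr0n (negPf kj) mul0r.
case: kl; apply/mnmP => j; have [->|ji] := eqVneq j i.
  rewrite !at_i // => j' j'i; apply/eqP.
  by have := k0 j'; rewrite j'i => /negbFE.
by rewrite l0 //; apply/eqP; have := k0 j; rewrite ji => /negbFE.
Qed.

(** * The span of the powers in the symmetric algebra *)

Section PowerSpan.
Variables (F : fieldType) (V : vectType F) (S : comAlgType F).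
Variable iota : {linear V -> S}.

Let n := \dim {:V}.
Let b := vbasis {:V}.

Definition basis_monomial (k : 'X_{1..n}) : S := \prod_(i < n) iota b`_i ^+ k i.

Lemma power_expansion t (x : 'I_n -> F) :
  iota (\sum_(i < n) x i *: b`_i) ^+ t =
  \sum_(k <- msupp (gen_pow n F t))
     ((gen_pow n F t)@_k * \prod_(i < n) x i ^+ k i) *: basis_monomial k.
Proof.
pose y i := x i *: iota b`_i.
transitivity (mmap (in_alg S) y (gen_pow n F t)).
  rewrite /gen_pow rmorphXn rmorph_sum linear_sum /=; congr (_ ^+ t).
  by apply: eq_bigr => i _; rewrite mmapX mmap1U linearZ.
apply: eq_bigr => k _; rewrite mulr_algl -scalerA; congr (_ *: _).
rewrite /mmap1 /basis_monomial -scaler_prod.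
by apply: eq_bigr => i _; rewrite exprZn.
Qed.

(** Interpolating exponents up to t would take t + 1 elements of F; t are enough
because the powers are homogeneous. They interpolate exponents with all entries
below t, and the exponents of degree t left over are those of pure powers, which
are dealt with first and then subtracted. *)
Lemma basis_monomial_in_power_span t (k : 'X_{1..n}) :
  (exists f : 'I_t -> F, injective f) ->
  k \in msupp (gen_pow n F t) -> power_span iota t (basis_monomial k).
Proof.
case=> f f_inj kP.
pose Y (x : 'I_n -> F) := iota (\sum_(i < n) x i *: b`_i) ^+ t.
have Y_span x : power_span iota t (Y x).
  by apply: mem_lin_span; exists (\sum_(i < n) x i *: b`_i).
have cancel_coeff l : l \in msupp (gen_pow n F t) ->
    power_span iota t ((gen_pow n F t)@_l *: basis_monomial l) ->
    power_span iota t (basis_monomial l).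
  rewrite mcoeff_msupp => Pl /(lin_spanZ ((gen_pow n F t)@_l)^-1).
  by rewrite scalerA mulVf // scale1r.
pose small (l : 'X_{1..n}) := [forall i, l i < t]%N.
have big_span l : l \in msupp (gen_pow n F t) -> ~~ small l ->
    power_span iota t (basis_monomial l).
  move=> lP; rewrite negb_forall => /existsP[i]; rewrite -leqNgt => tli.
  apply: cancel_coeff => //; suff <- : Y (fun j => (j == i)%:R) =
    (gen_pow n F t)@_l *: basis_monomial l by [].
  rewrite /Y power_expansion (bigD1_seq l) ?msupp_uniq //=.
  rewrite (full_exponent_delta lP) // eqxx mulr1 big1_seq ?addr0 //.
  move=> k' /andP[k'l k'P].
  by rewrite (full_exponent_delta lP) // (negPf k'l) mulr0 scale0r.
have [k_small|] := boolP (small k); last exact: big_span.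
pose code (l : 'X_{1..n}) (l_small : small l) :=
  [ffun i => Ordinal (forallP l_small i)].
have [B B_interp] := grid_interpolation (code k k_small) f_inj.
apply: cancel_coeff => //.
(* R l is the weight that the combination of the powers at the grid points,
   with coefficients B, puts on the exponent l; it is uncontrolled on
   exponents that are not small, but their monomials are already in the span. *)
pose R l := \sum_(x : {ffun 'I_n -> 'I_t}) B x * \prod_(i < n) f (x i) ^+ l i.
have R_small l : small l -> R l = (l == k)%:R.
  move=> l_small; have := B_interp (code l l_small).
  under eq_bigr do under eq_bigr do rewrite ffunE /=.
  rewrite -/(R l) => ->; congr (_%:R); congr nat_of_bool.
  apply/eqP/eqP => [e|lk].
    by apply/mnmP => i; have /ffunP/(_ i) := e; rewrite !ffunE => /(congr1 val).
  by apply/ffunP => i; apply: val_inj; rewrite !ffunE /= lk.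
have -> : (gen_pow n F t)@_k *: basis_monomial k =
    \sum_x B x *: Y (fun i => f (x i))
    + \sum_(l <- msupp (gen_pow n F t) | ~~ small l)
        - ((gen_pow n F t)@_l * R l) *: basis_monomial l.
  under [X in _ = X + _]eq_bigr do
    [rewrite /Y power_expansion scaler_sumr;
     under eq_bigr do rewrite scalerA mulrCA].
  rewrite exchange_big /=.
  under eq_bigr do rewrite -scaler_suml -mulr_sumr -/(R _).
  rewrite (bigID small) /= -addrA -big_split /= [X in _ + X]big1 ?addr0;
    last first.
    by move=> l _; rewrite scaleNr subrr.
  rewrite -big_filter (bigD1_seq k) ?filter_uniq ?msupp_uniq //=; last first.
    by rewrite mem_filter k_small.
  rewrite R_small // eqxx mulr1 big1_seq ?addr0 // => l.
  rewrite mem_filter => /and3P[lk l_small _].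
  by rewrite R_small // (negPf lk) mulr0 scale0r.
apply: lin_spanD.
  by apply: lin_span_sum => x _; apply: lin_spanZ; apply: Y_span.
rewrite big_seq_cond; apply: lin_span_sum => l /andP[lP l_big].
by apply: lin_spanZ; apply: big_span.
Qed.

(** The algebra morphism from S to the polynomial ring that extends the
coordinate map of V sends b^k to X^k, so independence is inherited from the
monomials X^k. *)
Lemma basis_monomial_free (r : seq 'X_{1..n}) (c : 'I_(size r) -> F) :
  is_symmetric_algebra iota -> uniq r ->
  \sum_(i < size r) c i *: basis_monomial (nth 0%MM r i) = 0 ->
  forall i, c i = 0.
Proof.
move=> hS r_uniq c0 i.
have [[g gE] _] := hS _ (@sym_iota F V : {linear V -> {mpoly F[\dim {:V}]}}).
have g_mon k : g (basis_monomial k) = 'X_[k].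
  rewrite rmorph_prod mpolyXE_id; apply: eq_bigr => j _.
  by rewrite rmorphXn /= gE; congr (_ ^+ _); exact: sym_iota_basis.
have : \sum_(j < size r) c j *: 'X_[nth 0%MM r j] = 0 :> {mpoly F[n]}.
  transitivity (g 0); last by rewrite raddf0.
  rewrite -c0 linear_sum; apply: eq_bigr => j _.
  by rewrite linearZ /= g_mon.
move=> /(congr1 (mcoeff (nth 0%MM r i))).
rewrite mcoeff0 raddf_sum (bigD1 i) //= big1 ?addr0 => [|j ji].
  by rewrite mcoeffZ mcoeffX eqxx mulr1.
by rewrite mcoeffZ mcoeffX nth_uniq // (inj_eq val_inj) (negPf ji) mulr0.
Qed.

Lemma power_span_dim t :
  is_symmetric_algebra iota -> (exists f : 'I_t -> F, injective f) ->
  has_dim (power_span iota t) (size (msupp (gen_pow n F t))).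
Proof.
move=> hS hF; set r := msupp _.
exists (fun i => basis_monomial (nth 0%MM r i)); split=> [c|].
  by apply: basis_monomial_free; rewrite ?msupp_uniq.
apply: lin_span_basis => [_ [a ->]|i]; last first.
  by apply: basis_monomial_in_power_span; rewrite ?mem_nth.
rewrite (coord_vbasis (memvf a)) power_expansion (big_nth 0%MM) big_mkord.
by eexists.
Qed.

Lemma power_span_sym t s : power_span iota t s -> sym_power iota t s.
Proof.
case=> k [c [x [xP ->]]]; apply: lin_span_sum => i _; apply: lin_spanZ.
have [a ->] := xP i; apply: mem_lin_span; exists (fun=> a).
by rewrite prodr_const card_ord.
Qed.

End PowerSpan.

Theorem corollary1 (m p t : nat) (F : fieldType) (V : vectType F)
    (hV : \dim {:V} = m.+1) (hp : p \in [pchar F])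
    (d : nat -> nat) (n : nat)
    (d_lt : forall l : nat, (d l < p)%N)
    (d_fin : forall l : nat, (n <= l)%N -> d l = 0%N)
    (t_base_p : t = (\sum_(l < n) d l * p ^ l)%N)
    (hF : exists f : 'I_t -> F, injective f)
    (S : comAlgType F) (iota : {linear V -> S})
    (hS : is_symmetric_algebra iota) :
  (\prod_(l < n) 'C(m + d l, d l) = \prod_(l < n) 'C(m + d l, m))%N /\
  (forall s : S, power_span iota t s -> sym_power iota t s) /\
  has_dim (power_span iota t) (\prod_(l < n) 'C(m + d l, d l))%N.
Proof.
split; first by apply: eq_bigr => l _; rewrite -bin_sub ?leq_addl ?addnK.
split; first exact: power_span_sym.
have := power_span_dim hS hF.
by rewrite hV {2}t_base_p (size_msupp_gen_pow_digits _ _ hp d_lt).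
Qed.
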